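(* For any fixed $T\in\mathbb{N}_{>0}$ and $m\in\mathbb{N}_{>0}$, the decision problem FireFightingInTime restricted to instances with these values of $T$ and $m$ is solvable in polynomial time.
   Context: All graphs are finite, simple and undirected. For a graph $G=(V,E)$ and $W\subseteq V$, $N(W)$ is the set of nodes in $V\setminus W$ adjacent to at least one node of $W$. For $m\in\mathbb{N}_{>0}$, an $m$-strategy of length $T$ is a sequence $(F_1,\dots,F_T)$ of subsets of $V$ with $|F_i|\le m$. Its burning sets are $B_0=V$ and $B_t=(B_{t-1}\setminus F_t)\cup N(B_{t-1}\setminus F_t)$ for $t\ge1$, where $F_t=\emptyset$ for $t>T$. The strategy is winning if $B_T=\emptyset$. FireFightingInTime: given $G$, $m$ and $T$, decide whether there is a winning $m$-strategy for $G$ of length $T$. *)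

(* Defs.v *)
From HB Require Import structures.
From mathcomp Require Import all_boot all_order all_algebra.

Set Implicit Arguments.
Unset Strict Implicit.
Unset Printing Implicit Defensive.

Record sgraph (V : finType) := SGraph {
  adj :> rel V;
  adj_sym : symmetric adj;
  adj_irr : irreflexive adj
}.

Section FireFighting.
Variables (V : finType) (G : sgraph V).

Definition nbh (W : {set V}) : {set V} :=
  [set v | (v \notin W) && [exists u in W, adj G u v]].

(* F_(t+1) is [nth set0 F t], which is empty beyond the length of F. *)
Fixpoint burning (F : seq {set V}) (t : nat) : {set V} :=
  if t is s.+1 then
    let U := burning F s :\: nth set0 F s in U :|: nbh U
  else setT.

Definition winning (F : seq {set V}) : Prop := burning F (size F) = set0.

Definition winning_in_time (m T : nat) : Prop :=
  exists F : T.-tuple {set V},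
    (forall i : 'I_T, #|tnth F i| <= m) /\ winning F.

End FireFighting.

(* Deterministic Turing machines with one two-way infinite tape and input
   alphabet A. Tape symbols: None is the blank, Some (inl a) an input letter,
   Some (inr x) an auxiliary symbol. *)
Inductive move := MoveLeft | MoveRight | Stay.

Section TuringMachines.
Variable A : finType.

Record TM := MkTM {
  tm_state : finType;
  tm_aux : finType;
  tm_start : tm_state;
  (* None: still running; Some b: halted, accepting iff b. *)
  tm_verdict : tm_state -> option bool;
  tm_delta : tm_state -> option (A + tm_aux) ->
             tm_state * option (A + tm_aux) * move
}.

Section Semantics.
Variable M : TM.

Definition tm_symbol : Type := option (A + tm_aux M).

(* The tape content is: the reverse of [cf_left], the scanned symbol
   [cf_head], then [cf_right]; all other cells are blank. *)
Record config := Config {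
  cf_state : tm_state M;
  cf_left : seq tm_symbol;
  cf_head : tm_symbol;
  cf_right : seq tm_symbol
}.

Definition init_config (w : seq A) : config :=
  let tape := [seq Some (inl a) : tm_symbol | a <- w] in
  Config (tm_start M) [::] (head None tape) (behead tape).

Definition step (c : config) : config :=
  if tm_verdict (cf_state c) is Some _ then c else
  let: (q, s, d) := tm_delta (cf_state c) (cf_head c) in
  match d with
  | MoveLeft =>
      Config q (behead (cf_left c)) (head None (cf_left c)) (s :: cf_right c)
  | MoveRight =>
      Config q (s :: cf_left c) (head None (cf_right c)) (behead (cf_right c))
  | Stay => Config q (cf_left c) s (cf_right c)
  end.

Definition verdict_after (w : seq A) (t : nat) : option bool :=
  tm_verdict (cf_state (iter t step (init_config w))).

(* Halted configurations are fixed by [step], so this says that M halts on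
   every input w within p(|w|) steps, accepting exactly the words of L. *)
Definition decides_in_time (L : seq A -> Prop) (p : {poly nat}) : Prop :=
  forall w : seq A, exists2 b : bool,
    verdict_after w (p.[size w])%R = Some b & (b <-> L w).

End Semantics.

Definition poly_time_decidable (L : seq A -> Prop) : Prop :=
  exists (M : TM) (p : {poly nat}), decides_in_time M L p.

End TuringMachines.

Definition language (A : finType) (I : Type) (enc : I -> seq A)
    (yes : I -> Prop) : seq A -> Prop :=
  fun w => exists2 i : I, yes i & w = enc i.

Record ffit_instance := FFITInstance {
  ffit_order : nat;
  ffit_graph : sgraph 'I_ffit_order;
  ffit_m : nat;
  ffit_T : nat
}.

Definition fire_fighting_in_time (I : ffit_instance) : Prop :=
  winning_in_time (ffit_graph I) (ffit_m I) (ffit_T I).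

(* Words over {0, 1, #}; None is the separator #. *)
Definition letter : finType := option bool.

(* Binary expansion, least significant bit first; 0 is written "0" *)
Definition binary (n : nat) : seq letter :=
  mkseq (fun i => Some (odd (n %/ 2 ^ i))) (trunc_log 2 n).+1.

Definition adj_matrix (n : nat) (G : sgraph 'I_n) : seq letter :=
  [seq Some (adj G x y) | x <- enum 'I_n, y <- enum 'I_n].

Definition encode_ffit (I : ffit_instance) : seq letter :=
  binary (ffit_order I) ++ None :: adj_matrix (ffit_graph I) ++
  None :: binary (ffit_m I) ++ None :: binary (ffit_T I).

Definition fire_fighting_in_time_fixed (T m : nat) (I : ffit_instance) : Prop :=
  [/\ ffit_T I = T, ffit_m I = m & fire_fighting_in_time I].

(* Main.v *)
Require Import Defs.
From HB Require Import structures.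
From mathcomp Require Import all_boot all_order all_algebra.
From mathcomp Require Import boolp.

(** Each step of a strategy extinguishes at most [m] nodes and fire never
    leaves the surviving nodes, so [#|B_t| >= #|V| - m * t].  A graph with a
    winning [m]-strategy of length [T] thus has at most [m * T] nodes: for fixed
    [T] and [m] the yes-instances have bounded size, and a language of words of
    bounded length is decided in linear time by storing the input in the
    finite control. *)

Section BoundedLanguage.
Variables (A : finType) (L : seq A -> Prop) (K : nat).

(* State [inl u] has read the prefix [u]; state [inr b] has halted with
   verdict [b]. *)
Definition table_delta (q : (K.-bseq A + bool)%type) (s : option (A + void)) :
    (K.-bseq A + bool) * option (A + void) * move :=
  match q, s with
  | inl u, Some (inl a) =>
      if insub (rcons u a) is Some v then (inl v, s, MoveRight)
      else (inr false, s, Stay)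
  | inl u, _ => (inr `[< L u >], s, Stay)
  | inr b, _ => (inr b, s, Stay)
  end.

Definition table_verdict (q : (K.-bseq A + bool)%type) : option bool :=
  if q is inr b then Some b else None.

Definition table_TM : TM A :=
  @MkTM A (K.-bseq A + bool)%type void (inl [bseq])
    table_verdict table_delta.

Hypothesis L_bounded : forall w, L w -> size w <= K.

Lemma iter_step_halted (M : TM A) (c : config M) (b : bool) (t : nat) :
  tm_verdict (cf_state c) = Some b -> iter t (@step A M) c = c.
Proof. by move=> cb; elim: t => //= t ->; rewrite /step cb. Qed.

(** Induction on [w] needs an arbitrary stored prefix [u] and left tape [l]. The step beyond
    [size w] scans the blank after the input. *)
Lemma table_TM_run (w : seq A) (u : K.-bseq A) (l : seq (tm_symbol table_TM)) :
  let tape := [seq Some (inl a) : tm_symbol table_TM | a <- w] in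
  tm_verdict (cf_state (iter (size w).+1 (@step A table_TM)
    (@Config A table_TM (inl u) l (head None tape) (behead tape))))
  = Some `[< L (u ++ w) >].
Proof.
elim: w u l => [|a w IHw] u l; first by rewrite /= /step /= cats0.
move=> tape; rewrite iterSr {}/tape {2}/step /=; case: insubP => [v _ def_v|long_u] /=.
  by rewrite -cat_rcons -def_v -(IHw v (Some (inl a) :: l)).
(* On overflow the machine rejects early and then idles, rightly so: the whole word is longer than
   [K]. *)
rewrite (@iter_step_halted table_TM _ false) //=.
congr Some; apply/esym/asboolPn => /L_bounded; apply/negP; rewrite -ltnNge.
rewrite -ltnNge size_rcons in long_u.
by rewrite size_cat addnS ltnS (leq_trans _ (leq_addr _ _)).
Qed.

Lemma bounded_language_poly_time : poly_time_decidable L.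
Proof.
exists table_TM, ('X + 1)%R => w; exists `[< L w >]; last by split=> /asboolP.
(* Swapping the summands gives [1 + size w], convertible to [(size w).+1]. *)
by rewrite !hornerE GRing.addrC; exact: (table_TM_run w [bseq] [::]).
Qed.

End BoundedLanguage.

Lemma card_burning (V : finType) (G : sgraph V) (m : nat) (F : seq {set V})
    (t : nat) :
  (forall s, #|nth set0 F s| <= m) -> #|V| <= #|burning G F t| + m * t.
Proof.
move=> Fm; elim: t => [|t IHt] /=; first by rewrite cardsT leq_addr.
apply: leq_trans IHt _; rewrite mulnS addnA leq_add2r.
(* A node of [B] either is among the at most [m] extinguished ones or survives into the next burning
   set. *)
set B := burning G F t; rewrite -(cardsID (nth set0 F t) B) addnC.
apply: leq_add; first exact/subset_leq_card/subsetUl.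
exact/(leq_trans _ (Fm t))/subset_leq_card/subsetIr.
Qed.

Lemma winning_in_time_card (V : finType) (G : sgraph V) (m T : nat) :
  winning_in_time G m T -> #|V| <= m * T.
Proof.
case=> F [Fm]; rewrite /winning size_tuple => F_wins.
rewrite -[m * T]add0n -(cards0 V) -F_wins; apply: card_burning => s.
have [sT|Ts] := ltnP s T; last by rewrite nth_default ?size_tuple ?cards0.
by rewrite -(tnth_nth set0 F (Ordinal sT)).
Qed.

Lemma size_encode_ffit (I : ffit_instance) :
  size (encode_ffit I) =
  (trunc_log 2 (ffit_order I)).+1 + (ffit_order I * ffit_order I +
    ((trunc_log 2 (ffit_m I)).+1 + (trunc_log 2 (ffit_T I)).+2).+1).+1.
Proof.
rewrite /encode_ffit size_cat /= size_cat /= size_cat /=.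
by rewrite !size_map !size_iota size_allpairs size_enum_ord.
Qed.

Theorem theorem9 (T m : nat) (hT : 0 < T) (hm : 0 < m) :
  poly_time_decidable
    (language encode_ffit (fire_fighting_in_time_fixed T m)).
Proof.
(* The bound is the encoding length of an instance with [m * T] nodes; this length is monotone in
   the number of nodes. *)
apply: (@bounded_language_poly_time _ _ ((trunc_log 2 (m * T)).+1 +
  ((m * T) * (m * T) + ((trunc_log 2 m).+1 + (trunc_log 2 T).+2).+1).+1)).
move=> _ [I [IT Im /winning_in_time_card In] ->].
rewrite card_ord IT Im in In; rewrite size_encode_ffit IT Im.
by rewrite leq_add ?ltnS ?leq_add2r ?leq_mul ?leq_trunc_log.
Qed.
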